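(* Let $\mathbb{K}$ be a non-Archimedean valued field with valuation $|\cdot|$, let $n\geq 2$ be an integer, and let $p(z)=c_0+c_1z+\cdots+c_{n-1}z^{n-1}+z^n\in\mathbb{K}[z]$ with $c_0\neq 0$. If $\lambda\in\mathbb{K}$ is a zero of $p$, then at least one of the following holds: $$\frac{1}{|\lambda|^2}\leq \frac{1}{|c_0|}\max\left\{1,\frac{|c_j|}{|c_0|}\right\}\quad\text{for some } 2\leq j\leq n-1;$$ or $$\frac{1}{|\lambda|}\left|\frac{1}{\lambda}+\frac{c_1}{c_0}\right|\leq \frac{1}{|c_0|};$$ or $$\frac{1}{|\lambda|^2}\leq \left(\max\left\{1,\frac{|c_j|}{|c_0|}\right\}\right)\left(\max\left\{1,\frac{|c_k|}{|c_0|}\right\}\right)\quad\text{for some } 2\leq j,k\leq n-1,\ j\neq k;$$ or $$\frac{1}{|\lambda|}\left|\frac{1}{\lambda}+\frac{c_1}{c_0}\right|\leq \max\left\{1,\frac{|c_j|}{|c_0|}\right\}\quad\text{for some } 2\leq j\leq n-1.$$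
   Context: A non-Archimedean valued field is a field $\mathbb{K}$ with a map $|\cdot|:\mathbb{K}\to[0,\infty)$ such that $|x|=0$ iff $x=0$, $|xy|=|x||y|$, and $|x+y|\leq\max\{|x|,|y|\}$ for all $x,y\in\mathbb{K}$. *)

(* Defs.v *)
From HB Require Import structures.
From mathcomp Require Import all_boot all_order all_algebra reals.
Set Implicit Arguments.
Unset Strict Implicit.
Unset Printing Implicit Defensive.
Import Order.TTheory GRing.Theory Num.Theory.
Local Open Scope ring_scope.

Record nonarch_valuation (R : realType) (K : fieldType) (v : K -> R) : Prop :=
  NonarchValuation {
    val_ge0 : forall x, 0 <= v x;
    val_eq0 : forall x, v x = 0 <-> x = 0;
    valM : forall x y, v (x * y) = v x * v y;
    val_leD : forall x y, v (x + y) <= Num.max (v x) (v y)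
  }.

(* Main.v *)
Require Import Defs.
From HB Require Import structures.
From mathcomp Require Import all_boot all_order all_algebra reals.
From mathcomp Require Import zify ring.
Set Implicit Arguments.
Unset Strict Implicit.
Unset Printing Implicit Defensive.
Import Order.TTheory GRing.Theory Num.Theory.
Local Open Scope ring_scope.

(** Dividing [p.[lambda] = 0] by [p`_0 * lambda ^+ 2] isolates the two lowest
    coefficients:
      [lambda^-1 * (lambda^-1 + c1 / c0) = - \sum_(2 <= j <= n) cj / c0 * lambda ^+ (j - 2)].
    A sum in an ultrametric field is no larger than its largest term, so with
    [A] the valuation of the left-hand side there is an index [2 <= j <= n] with
    [A <= |cj / c0| * |lambda| ^+ (j - 2)] ([val_sum_dominant],
    [root_dominant_coef]).

    If [|lambda| <= 1], the power of [|lambda|] can be dropped: [j < n] gives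
    the fourth alternative, and [j = n], where [cj = 1], gives the second.
    If [|lambda| > 1] then [1 / |lambda| ^+ 2 <= 1], which is the third
    alternative as soon as there are two distinct indices between [2] and
    [n - 1], that is for [n >= 4].  The degrees [2] and [3] remain.  There the
    power of [|lambda|] is trivial, except when [n = j = 3]; in that case,
    either the first alternative holds or [1 / |c0| < 1 / |lambda| ^+ 2], and
    then [A <= |lambda| / |c0| <= 1 / |lambda| <= 1] gives the fourth. *)

Section NonarchValuation.
Variables (R : realType) (K : fieldType) (v : K -> R).
Hypothesis v_val : nonarch_valuation v.

Lemma val_0 : v 0 = 0. Proof. exact/(Defs.val_eq0 v_val). Qed.

Lemma val_gt0 x : x != 0 -> 0 < v x.
Proof.
move=> x0; rewrite lt_def (val_ge0 v_val) andbT.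
by apply: contra x0 => /eqP /(Defs.val_eq0 v_val) ->.
Qed.

Lemma val_1 : v 1 = 1.
Proof.
apply: (mulfI (lt0r_neq0 (val_gt0 (oner_neq0 K)))).
by rewrite -(Defs.valM v_val) !mulr1.
Qed.

Lemma val_N x : v (- x) = v x.
Proof.
suff vN1 : v (-1) = 1 by rewrite -mulN1r (Defs.valM v_val) vN1 mul1r.
apply/eqP; rewrite -(@pexpr_eq1 _ (v (-1)) 2) ?(val_ge0 v_val) //.
by rewrite expr2 -(Defs.valM v_val) mulrNN mulr1 val_1.
Qed.

Lemma val_V x : v x^-1 = (v x)^-1.
Proof.
have [->|x0] := eqVneq x 0; first by rewrite invr0 val_0 invr0.
apply: (mulfI (lt0r_neq0 (val_gt0 x0))).
by rewrite -(Defs.valM v_val) !divff ?val_1 ?lt0r_neq0 ?val_gt0.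
Qed.

Lemma val_X x k : v (x ^+ k) = v x ^+ k.
Proof.
by elim: k => [|k IHk]; rewrite ?expr0 ?val_1 // !exprS (Defs.valM v_val) IHk.
Qed.

(** The bound is given by an index that attains it rather than by a maximum, so
    that the position of that index can be the subject of a case analysis. *)
Lemma val_sum_dominant (I : eqType) (s : seq I) (F : I -> K) :
  s != [::] -> exists2 i, i \in s & v (\sum_(i <- s) F i) <= v (F i).
Proof.
elim: s => [//|a s IHs] _; rewrite big_cons.
have [->|/IHs [i i_s le_i]] := eqVneq s [::].
  by exists a; rewrite ?mem_head // big_nil addr0.
have := val_leD v_val (F a) (\sum_(j <- s) F j).
rewrite le_max => /orP[le_a|le_s]; first by exists a; rewrite ?mem_head.
by exists i; [rewrite in_cons i_s orbT | exact: le_trans le_s le_i].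
Qed.

End NonarchValuation.

Lemma root_inv_eq (K : fieldType) (p : {poly K}) (n : nat) (x : K) :
    (2 <= n)%N -> size p = n.+1 -> p`_0 != 0 -> x != 0 -> root p x ->
  x^-1 * (x^-1 + p`_1 / p`_0) =
    - \sum_(2 <= j < n.+1) p`_j / p`_0 * x ^+ (j - 2).
Proof.
move=> n_ge2 size_p p0 x0 /rootP.
rewrite horner_coef size_p -(big_mkord xpredT (fun i => p`_i * x ^+ i)).
rewrite big_ltn // big_ltn ?ltnS ?(ltnW n_ge2) // expr0 expr1 mulr1 => px0.
set S := \sum_(2 <= j < n.+1) _.
have tailE : \sum_(2 <= j < n.+1) p`_j * x ^+ j = p`_0 * x ^+ 2 * S.
  rewrite mulr_sumr; apply: eq_big_nat => j /andP[j_ge2 _].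
  have -> : x ^+ j = x ^+ 2 * x ^+ (j - 2) by rewrite -exprD subnKC.
  by field.
move: px0; rewrite tailE => px0.
have cx0 : p`_0 * x ^+ 2 != 0 by rewrite mulf_neq0 ?expf_neq0.
apply: (mulfI cx0); rewrite mulrN; apply/eqP; rewrite -subr_eq0 opprK; apply/eqP.
by rewrite -[RHS]px0; field; rewrite x0 p0.
Qed.

(** Applies the ultrametric inequality to [root_inv_eq].  This has the form of a
    Newton polygon estimate: the two lowest terms are balanced by one other. *)
Lemma root_dominant_coef (R : realType) (K : fieldType) (v : K -> R)
    (p : {poly K}) (n : nat) (x : K) :
    nonarch_valuation v -> (2 <= n)%N -> size p = n.+1 ->
    p`_0 != 0 -> x != 0 -> root p x ->
  exists2 j, (2 <= j <= n)%N &
    1 / v x * v (1 / x + p`_1 / p`_0) <= v p`_j / v p`_0 * v x ^+ (j - 2).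
Proof.
move=> v_val n_ge2 size_p p0 x0 px.
have range_neq0 : index_iota 2 n.+1 != [::].
  by rewrite -size_eq0 size_iota subn_eq0 -ltnNge ltnS.
have [j] := val_sum_dominant v_val (fun j => p`_j / p`_0 * x ^+ (j - 2))
  range_neq0.
rewrite mem_index_iota ltnS => jn le_j; exists j => //; move: le_j.
rewrite -(val_N v_val (\sum_(_ <- _) _)) -root_inv_eq //.
by rewrite !(Defs.valM v_val) (val_X v_val) !(val_V v_val) !div1r.
Qed.

Theorem theorem2p5 (R : realType) (K : fieldType) (v : K -> R)
    (v_val : nonarch_valuation v)
    (n : nat) (n_ge2 : (2 <= n)%N)
    (p : {poly K}) (p_monic : p \is monic) (size_p : size p = n.+1)
    (p0_neq0 : p`_0 != 0)
    (lambda : K) (p_lambda : root p lambda) :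
  (exists j : nat, (2 <= j <= n.-1)%N /\
     1 / v lambda ^+ 2 <= 1 / v p`_0 * Num.max 1 (v p`_j / v p`_0))
  \/
  (1 / v lambda * v (1 / lambda + p`_1 / p`_0) <= 1 / v p`_0)
  \/
  (exists j k : nat, [/\ (2 <= j <= n.-1)%N, (2 <= k <= n.-1)%N, j <> k &
     1 / v lambda ^+ 2 <=
       Num.max 1 (v p`_j / v p`_0) * Num.max 1 (v p`_k / v p`_0)])
  \/
  (exists j : nat, (2 <= j <= n.-1)%N /\
     1 / v lambda * v (1 / lambda + p`_1 / p`_0) <=
       Num.max 1 (v p`_j / v p`_0)).
Proof.
have x0 : lambda != 0.
  apply: contra p0_neq0 => /eqP x0.
  by move: p_lambda; rewrite x0 /root horner_coef0.
have [j /andP[j_ge2 j_le]] :=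
  root_dominant_coef v_val n_ge2 size_p p0_neq0 x0 p_lambda.
have pn : p`_n = 1 by move: p_monic; rewrite monicE lead_coefE size_p => /eqP.
set A := _ * v _; set l := v lambda; set c := v p`_0 => leA.
have l0 : 0 < l by exact: val_gt0.
have c0 : 0 < c by exact: val_gt0.
have vn : v p`_n = 1 by rewrite pn val_1.
(* Once the power of [l] is bounded by 1, the dominant index decides between
   the second and the fourth alternatives. *)
have small_pow : l ^+ (j - 2) <= 1 ->
    A <= 1 / c \/
    (exists j, (2 <= j <= n.-1)%N /\ A <= Num.max 1 (v p`_j / c)).
  move=> pow_le1; have {}leA : A <= v p`_j / c.
    by apply: le_trans leA _; rewrite ler_piMr // divr_ge0 ?(val_ge0 v_val).
  case: (ltngtP j n) j_le => // [j_lt|j_n] _.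
    right; exists j; split; last by rewrite le_max leA orbT.
    by rewrite j_ge2 -ltnS prednK // (ltn_trans _ n_ge2).
  by left; rewrite -vn -j_n.
have [l_le1|l_gt1] := leP l 1.
  have [|] := small_pow (exprn_ile1 _ (ltW l0) l_le1); first by right; left.
  by right; right; right.
have inv_le1 k : 1 / l ^+ k <= 1.
  by rewrite div1r invf_le1 ?exprn_gt0 // exprn_ege1 // ltW.
have [n_ge4|n_lt4] := leqP 4 n.
  right; right; left; exists 2, 3; split; [lia | lia | by [] |].
  by apply: le_trans (inv_le1 2) _; rewrite mulr_ege1 // le_max lexx.
have [j2|j_neq2] := eqVneq j 2.
  have pow_le1 : l ^+ (j - 2) <= 1 by rewrite j2 expr0.
  by have [|] := small_pow pow_le1; [right; left | right; right; right].
have [j3 n3] : j = 3 /\ n = 3 by lia.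
have [first_alt|] := leP (1 / l ^+ 2) (1 / c * Num.max 1 (v p`_2 / c)).
  by left; exists 2; rewrite n3.
move=> c_lt; right; right; right; exists 2; rewrite n3; split => //.
have {}c_lt : 1 / c < 1 / l ^+ 2.
  apply: le_lt_trans c_lt; rewrite ler_peMr ?le_max ?lexx //.
  by rewrite divr_ge0 // ltW.
rewrite le_max; apply/orP; left; apply: le_trans (inv_le1 1).
apply: le_trans leA _; rewrite j3 -n3 vn n3 expr1.
have -> : 1 / l = 1 / l ^+ 2 * l by field; rewrite gt_eqF.
by rewrite ler_wpM2r // ltW.
Qed.
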